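(* Let $\beta=\frac{1+\sqrt5}{2}$, $\bar\beta=\frac{1-\sqrt5}{2}$, $\alpha=\frac{1}{\sqrt5}$, and in $\mathbb{R}^3$ let $$f_1=(\beta,1,0),\quad f_2=(\beta,-1,0),\quad f_3=(1,0,\beta),\quad f_4=(-1,0,\beta),\quad f_5=(0,\beta,1),\quad f_6=(0,\beta,-1).$$ Let $\mathcal{F}_e=\{e_j\}_{j=1}^6$ be the Parseval frame in $\mathbb{R}^3$ with $e_j=\frac{1}{\sqrt2\,\|f_j\|}f_j$, let $\mathsf{E}=\{E_j\}_{j=1}^6$ be a set of real numbers, and let $H_{\mathsf{E},e}=\sum_{j=1}^6E_j\langle\cdot,e_j\rangle e_j$ be the corresponding operator in $\mathbb{R}^3$. Then the eigenvalues of $H_{\mathsf{E},e}$ satisfy the equation $$\sum_{\sigma\in S_3}\operatorname{sgn}(\sigma)\prod_{i=1}^3W_{i,\sigma(i)}(\lambda)=0,$$ where, for $i,j\in\{1,2,3\}$, $$W_{i,j}(\lambda)=\begin{cases}E_j-E_{3+i}&\text{for } i+j=4,\\[2pt] \beta E_j-\bar\beta E_{3+i}-\dfrac{\lambda}{\alpha}&\text{for } i+j\neq4.\end{cases}$$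
   Context: $\langle\cdot,\cdot\rangle$ is the standard inner product on $\mathbb{R}^3$ and $S_3$ is the symmetric group on $\{1,2,3\}$. A Parseval frame in a Hilbert space $\mathcal{H}$ is a family $\{e_j\}$ with $\sum_j|\langle f,e_j\rangle|^2=\|f\|^2$ for all $f\in\mathcal{H}$. *)

(* Defs.v *)
(* MathComp; the field of real numbers is an arbitrary R : realType. *)
From HB Require Import structures.
From mathcomp Require Import all_boot all_order all_fingroup all_algebra.
From mathcomp Require Import reals ring.
Set Implicit Arguments.
Unset Strict Implicit.
Unset Printing Implicit Defensive.
Import Order.TTheory GRing.Theory Num.Theory.
Local Open Scope ring_scope.

Section Frames.
Context {R : realType} {n m : nat}.

Definition dot (u v : 'rV[R]_n) : R := \sum_(k < n) u 0 k * v 0 k.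

(* Euclidean norm; MathComp-Analysis's `|u| on matrices is the sup norm. *)
Definition enorm (u : 'rV[R]_n) : R := Num.sqrt (dot u u).

Definition parseval_frame (e : 'I_m -> 'rV[R]_n) : Prop :=
  forall u, \sum_(j < m) `|dot u (e j)| ^+ 2 = enorm u ^+ 2.

Definition frame_op (E : 'I_m -> R) (e : 'I_m -> 'rV[R]_n)
    (u : 'rV[R]_n) : 'rV[R]_n :=
  \sum_(j < m) E j *: (dot u (e j) *: e j).

Fact frame_op_is_linear E e : linear (frame_op E e).
Proof.
move=> a u v; rewrite /frame_op scaler_sumr -big_split /=.
apply: eq_bigr => j _.
have -> : dot (a *: u + v) (e j) = a * dot u (e j) + dot v (e j).
  rewrite /dot mulr_sumr -big_split /=; apply: eq_bigr => k _.
  by rewrite !mxE mulrDl mulrA.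
by rewrite !scalerA -scalerDl mulrDr; congr (_ *: _); ring.
Qed.

HB.instance Definition _ E e :=
  GRing.isLinear.Build R 'rV[R]_n 'rV[R]_n *:%R (frame_op E e)
    (frame_op_is_linear E e).

End Frames.

Section Icosahedron.
Context {R : realType}.

Definition beta : R := (1 + Num.sqrt 5) / 2.
Definition betabar : R := (1 - Num.sqrt 5) / 2.
Definition alpha : R := 1 / Num.sqrt 5.

Definition vec3 (x y z : R) : 'rV[R]_3 := \row_(k < 3) [:: x; y; z]`_k.

(* Families indexed by 1, ..., 6 are indexed here by 'I_6 = {0, ..., 5}. *)
Definition f_vec (j : 'I_6) : 'rV[R]_3 :=
  [:: vec3 beta 1 0; vec3 beta (-1) 0;
      vec3 1 0 beta; vec3 (-1) 0 beta;
      vec3 0 beta 1; vec3 0 beta (-1)]`_j.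

Definition e_frame (j : 'I_6) : 'rV[R]_3 :=
  (1 / (Num.sqrt 2 * enorm (f_vec j))) *: f_vec j.

Lemma e_frame_parseval : parseval_frame e_frame.
Proof.
have dotZ c (u v : 'rV[R]_3) : dot u (c *: v) = c * dot u v.
  by rewrite /dot mulr_sumr; apply: eq_bigr => k _; rewrite mxE mulrCA.
have dot0 (u : 'rV[R]_3) : 0 <= dot u u.
  by apply: sumr_ge0 => k _; rewrite -expr2 sqr_ge0.
have s5 : Num.sqrt 5 ^+ 2 = 5 :> R by rewrite sqr_sqrtr // ler0n.
have b2 : beta ^+ 2 = beta + 1.
  by rewrite /beta expr_div_n sqrrD s5; field; rewrite ?pnatr_eq0.
have b0 : 0 < beta by rewrite divr_gt0 // ltr_wpDr // sqrtr_ge0.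
have dotff j : dot (f_vec j) (f_vec j) = beta + 2.
  have -> : beta + 2 = beta ^+ 2 + 1 by rewrite b2; ring.
  case: j => [[|[|[|[|[|[|//]]]]]] lt_j];
    rewrite /dot /f_vec /vec3 !big_ord_recl big_ord0 !mxE /=; ring.
move=> u; rewrite [in RHS]/enorm sqr_sqrtr //.
have -> : \sum_(j < 6) `|dot u (e_frame j)| ^+ 2
    = (2 * (beta + 2))^-1 * \sum_(j < 6) dot u (f_vec j) ^+ 2.
  rewrite mulr_sumr; apply: eq_bigr => j _.
  rewrite real_normK ?num_real // dotZ exprMn div1r exprVn exprMn.
  by rewrite /enorm !sqr_sqrtr ?dotff // addr_ge0 // ltW.
apply: (mulfI (x := 2 * (beta + 2))).
  by rewrite mulf_neq0 // gt_eqF // addr_gt0.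
rewrite mulVKf; last by rewrite mulf_neq0 // gt_eqF // addr_gt0.
rewrite !big_ord_recl big_ord0 /dot /f_vec /vec3 !big_ord_recl !big_ord0.
rewrite !mxE /=.
set x := u 0 ord0; set y := u 0 _; set z := u 0 _.
have -> : 2 * (beta + 2) = 2 * (beta ^+ 2 + 1) by rewrite b2; ring.
ring.
Qed.

(* Splitting 'I_6 as 'I_(3 + 3), lshift 3 j is the index j and rshift 3 i the
   index 3 + i; the successors undo the shift to 0-based indices. *)
Definition W (E : 'I_6 -> R) (lambda : R) (i j : 'I_3) : R :=
  let E1 := E (lshift 3 j) in
  let E2 := E (rshift 3 i) in
  if (i.+1 + j.+1 == 4)%N then E1 - E2
  else beta * E1 - betabar * E2 - lambda / alpha.

End Icosahedron.

(* Main.v *)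
(* If [v] is an eigenvector of the frame operator, the vector
   [u = (<v, f_1>, <v, f_2>, <v, f_3>)] lies in the kernel of [W(lambda)]: for
   [P_i] orthogonal to the two vectors [f_(3+k)], [k <> i], the scalar
   [<P_i, H v - lambda v>] involves only [E_1], [E_2], [E_3] and [E_(3+i)], and
   it is the [i]-th entry of [W u] up to a constant once [<v, f_(3+i)>] is
   expressed through [u].  As [f_1], [f_2], [f_3] form a basis, [u] is nonzero,
   so [det W(lambda)], which is the alternating sum, vanishes. *)
Require Import Defs.
From HB Require Import structures.
From mathcomp Require Import all_boot all_order all_fingroup all_algebra.
From mathcomp Require Import reals.
From mathcomp Require Import ring.
Set Implicit Arguments.
Unset Strict Implicit.
Unset Printing Implicit Defensive.
Import Order.TTheory GRing.Theory Num.Theory.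
Local Open Scope ring_scope.

Lemma leigenvalue_eigenvector (K : fieldType) (V : vectType K) (f : 'End(V))
    (a : K) :
  passmx.leigenvalue f a -> exists2 v, v != 0 & f v = a *: v.
Proof.
move=> eig; exists (vpick (passmx.leigenspace f a)); first by rewrite vpick0.
have := memv_pick (passmx.leigenspace f a).
rewrite memv_ker add_lfunE opp_lfunE scale_lfunE id_lfunE.
by rewrite subr_eq0 => /eqP.
Qed.

Section Icosahedron.
Context {R : realType}.
Implicit Types (v : 'rV[R]_3) (E : 'I_6 -> R).

(** With [sqrt5_beta] and [betabarE] every constant becomes a polynomial in [beta], so later
    identities can be checked modulo [beta ^+ 2 = beta + 1]. *)
Lemma sqrt5_beta : Num.sqrt 5 = 2 * beta - 1 :> R.
Proof. by rewrite /beta; field. Qed.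

Lemma betabarE : betabar = 1 - beta :> R.
Proof. by rewrite /betabar /beta; field. Qed.

Lemma beta_sqr : beta ^+ 2 = beta + 1 :> R.
Proof.
have s5 : Num.sqrt 5 ^+ 2 = 5 :> R by rewrite sqr_sqrtr // ler0n.
by rewrite /beta expr_div_n sqrrD s5; field.
Qed.

Lemma beta_gt0 : 0 < beta :> R.
Proof. by rewrite divr_gt0 // ltr_wpDr // sqrtr_ge0. Qed.

Lemma dot_vec3 v (x y z : R) :
  dot v (vec3 x y z) = v 0 0 * x + v 0 1 * y + v 0 2 * z.
Proof.
rewrite /dot !big_ord_recl big_ord0 !mxE /= addr0 addrA.
by congr (_ * _ + v 0 _ * _ + v 0 _ * _); apply: val_inj.
Qed.

Lemma dot_f_vec (j : 'I_6) : dot (f_vec j) (f_vec j) = beta + 2 :> R.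
Proof.
have -> : beta + 2 = beta ^+ 2 + 1 :> R by rewrite beta_sqr; ring.
by case: j => [[|[|[|[|[|[|//]]]]]] lt_j];
  rewrite /f_vec /= dot_vec3 !mxE /=; ring.
Qed.

(** All six [f_vec j] have squared norm [beta + 2], so the normalizations merge into one scalar. *)
Lemma frame_op_e_frame E v :
  frame_op E e_frame v =
  (2 * (beta + 2))^-1 *: \sum_(j < 6) (E j * dot v (f_vec j)) *: f_vec j.
Proof.
rewrite /frame_op scaler_sumr; apply: eq_bigr => j _.
rewrite /e_frame; set c := 1 / _.
have -> : (2 * (beta + 2))^-1 = c ^+ 2 :> R.
  rewrite /c div1r exprVn exprMn /enorm !sqr_sqrtr ?dot_f_vec //.
  by rewrite addr_ge0 // ltW // beta_gt0.
have -> : dot v (c *: f_vec j) = c * dot v (f_vec j).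
  by rewrite /dot mulr_sumr; apply: eq_bigr => k _; rewrite mxE mulrCA.
by rewrite !scalerA; congr (_ *: _); ring.
Qed.

(* Orthogonal to the two vectors [f_(3+k)] with [k <> i]. *)
Definition dual_vec (i : 'I_3) : 'rV[R]_3 :=
  [:: vec3 2 0 0; vec3 beta (beta - 1) 1; vec3 beta (1 - beta) 1]`_i.

(** The scale of [dual_vec] makes its products with $f_j$, $j \le 3$, equal to $2$ if $i + j = 4$
    (1-based) and to $2\beta$ otherwise: twice the coefficients of $E_j$ in [W]. *)
Lemma W_dot E lambda v (i : 'I_3) :
  \sum_(j < 3) W E lambda i j * dot v (f_vec (lshift 3 j)) =
  (beta + 2) * dot (dual_vec i) (frame_op E e_frame v - lambda *: v).
Proof.
have b2 := beta_sqr.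
have b2_neq0 : beta + 2 != 0 :> R by rewrite gt_eqF // addr_gt0 // beta_gt0.
set D := \sum_(j < 6) (E j * dot v (f_vec j)) *: f_vec j
         - (2 * (beta + 2) * lambda) *: v.
have -> : frame_op E e_frame v - lambda *: v = (2 * (beta + 2))^-1 *: D.
  rewrite frame_op_e_frame scalerBr scalerA mulKf //.
  by rewrite mulf_neq0 // pnatr_eq0.
have -> : dot (dual_vec i) ((2 * (beta + 2))^-1 *: D)
    = (2 * (beta + 2))^-1 * dot D (dual_vec i).
  by rewrite /dot mulr_sumr; apply: eq_bigr => k _; rewrite mxE; ring.
apply: (mulfI (x := 2)); first by rewrite pnatr_eq0.
have -> x : 2 * ((beta + 2) * ((2 * (beta + 2))^-1 * x)) = x :> R by field.
have DE k : D 0 k = \sum_(j < 6) (E j * dot v (f_vec j)) * f_vec j 0 k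
                    - 2 * (beta + 2) * lambda * v 0 k.
  rewrite !mxE summxE; congr (_ - _).
  by apply: eq_bigr => j _; rewrite mxE.
(* Indices occur as [lshift], [rshift] and [lift] terms; numerals make equal ones syntactically
   equal for [ring]. *)
pose F (n : nat) := E (inord n).
have EF (j : 'I_6) : E j = F j by rewrite /F inord_val.
case: i => [[|[|[|//]]] lt_i]; rewrite /dual_vec /= dot_vec3 !DE;
  rewrite /W /alpha div1r invrK sqrt5_beta betabarE;
  rewrite !big_ord_recl !big_ord0 /f_vec /= !dot_vec3 !mxE /=;
  rewrite !EF /=; ring: b2.
Qed.

(** As $f_1 + f_2 = (2\beta, 0, 0)$, the first coordinate vanishes; then $f_1$ kills the second and
    $f_3$ the third. *)
Lemma dot_f_vec_eq0 v :
  (forall j : 'I_3, dot v (f_vec (lshift 3 j)) = 0) -> v = 0.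
Proof.
move=> v0; have b0 := beta_gt0.
have := v0 0; have := v0 1; have := v0 2.
rewrite /f_vec /= !dot_vec3 !mulr0 !addr0 !mulr1 mulrN1.
move=> xz xy xy'.
have x0 : v 0 0 = 0.
  apply: (mulIf (x := 2 * beta)); first by rewrite mulf_neq0 // gt_eqF.
  transitivity ((v 0 0 * beta - v 0 1) + (v 0 0 * beta + v 0 1)); first ring.
  by rewrite xy xy' addr0 mul0r.
move: xy' xz; rewrite x0 mul0r !add0r => y0 /eqP.
rewrite mulf_eq0 (gt_eqF b0) orbF => /eqP z0.
apply/rowP => k; rewrite mxE.
by case: k => [[|[|[|//]]] lt_k]; [rewrite -[RHS]x0 | rewrite -[RHS]y0 |
  rewrite -[RHS]z0]; congr (v 0 _); apply: val_inj.
Qed.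

End Icosahedron.

Theorem theorem16 (R : realType) (E : 'I_6 -> R) (lambda : R) :
  passmx.leigenvalue (linfun (frame_op E e_frame)) lambda ->
  \sum_(s : 'S_3) (-1) ^+ s * \prod_(i < 3) W E lambda i (s i) = 0.
Proof.
move=> /leigenvalue_eigenvector[v v_neq0]; rewrite lfunE /= => Hv.
pose A : 'M[R]_3 := \matrix_(i, j) W E lambda i j.
transitivity (\det A).
  apply: eq_bigr => s _; congr (_ * _).
  by apply: eq_bigr => i _; rewrite mxE.
(* [det0P] asks for a row vector in the left kernel, whereas [W_dot] gives a right kernel vector;
   hence the transpose. *)
apply/eqP; rewrite -det_tr; apply/det0P.
exists (\row_j dot v (f_vec (lshift 3 j : 'I_(3 + 3)))).
  apply: contra_neq v_neq0 => /rowP u0; apply: dot_f_vec_eq0 => j.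
  by have := u0 j; rewrite !mxE.
apply/rowP => i; rewrite !mxE.
transitivity (\sum_(j < 3) W E lambda i j * dot v (f_vec (lshift 3 j))).
  by apply: eq_bigr => j _; rewrite !mxE mulrC.
rewrite W_dot Hv subrr /dot big1 ?mulr0 // => k _.
by rewrite mxE mulr0.
Qed.
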